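(* Let $G$ be a finite group. The commuting graph $\Gamma(G)$ is the line graph of some graph if and only if $G$ is abelian.
   Context: All graphs are simple (no loops or multiple edges) and undirected. The commuting graph $\Gamma(G)$ of a group $G$ is the simple undirected graph whose vertex set is the set of all elements of $G$ (including the identity), in which two distinct elements $x$ and $y$ are adjacent if and only if $xy=yx$. The line graph $L(\Gamma)$ of a graph $\Gamma$ is the graph whose vertices are the edges of $\Gamma$, two distinct vertices of $L(\Gamma)$ being adjacent if and only if the corresponding edges of $\Gamma$ share an endpoint. A graph is ''the line graph of some graph'' if it is isomorphic to $L(\Gamma)$ for some simple graph $\Gamma$. *)

(* Defs.v *)
From mathcomp Require Import all_boot all_fingroup.
From mathcomp Require Import classical_sets.

Set Implicit Arguments.
Unset Strict Implicit.
Unset Printing Implicit Defensive.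

(* Simple undirected graphs; the vertex type is not required to be finite. *)
Record sgraph := SGraph {
  vertex :> Type;
  adj : vertex -> vertex -> Prop;
  adj_sym : forall x y, adj x y -> adj y x;
  adj_irrefl : forall x, ~ adj x x
}.

Arguments adj {s} _ _.

Definition sgraph_iso (X Y : sgraph) : Prop :=
  exists2 f : X -> Y, bijective f & forall x y, adj x y <-> adj (f x) (f y).

(* Edges are unordered pairs, encoded as sets {x, y} with x, y adjacent. *)
Definition is_edge (X : sgraph) (A : set X) : Prop :=
  exists x y : X, adj x y /\ A = [set x; y]%classic.

Definition edge (X : sgraph) : Type := {A : set X | is_edge A}.

Section LineGraph.
Variable X : sgraph.

Definition line_adj (a b : edge X) : Prop :=
  a <> b /\ exists x : X, sval a x /\ sval b x.

Fact line_adj_sym a b : line_adj a b -> line_adj b a.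
Proof.
by move=> [ab [x [ax bx]]]; split; [move=> ba; apply: ab | exists x].
Qed.

Fact line_adj_irrefl a : ~ line_adj a a.
Proof. by case. Qed.

Definition line_graph : sgraph := SGraph line_adj_sym line_adj_irrefl.

End LineGraph.

Definition is_line_graph (Y : sgraph) : Prop :=
  exists X : sgraph, sgraph_iso Y (line_graph X).

Section CommutingGraph.
Variables (gT : finGroupType) (G : {group gT}).

Definition commuting_adj (x y : {z : gT | z \in G}) : Prop :=
  x <> y /\ commute (sval x) (sval y).

Fact commuting_adj_sym x y : commuting_adj x y -> commuting_adj y x.
Proof. by move=> [xy cxy]; split; [move=> yx; apply: xy | apply: esym]. Qed.

Fact commuting_adj_irrefl x : ~ commuting_adj x x.
Proof. by case. Qed.

Definition commuting_graph : sgraph :=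
  SGraph commuting_adj_sym commuting_adj_irrefl.

End CommutingGraph.

(* Main.v *)
Require Import Defs.
From mathcomp Require Import all_boot all_fingroup.
From mathcomp Require Import boolp classical_sets.

(** Everything rests on the claw.  An edge has two endpoints, so among three
    edges meeting it two share an endpoint: a line graph has no induced claw
    ([line_graph_claw_free]).  In a commuting graph the identity is adjacent to
    every other vertex, and if [x] and [y] do not commute then [x], [y] and
    [x * y] are pairwise non-commuting, so together with the identity they form
    an induced claw.  Hence a group whose commuting graph is a line graph is
    abelian.

    Conversely the commuting graph of an abelian group is complete, and the
    complete graph on [V] is the line graph of the star whose leaves are the
    elements of [V] ([complete_is_line_graph]). *)

Lemma edge_inj (X : sgraph) (a b : edge X) : sval a = sval b -> a = b.
Proof.
by case: a b => [A Aedge] [B Bedge] /= eqAB; apply: eq_exist.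
Qed.

(** Each of the three edges meets [a] in one of the two endpoints of [a], so
    two of them meet it in the same endpoint. *)
Lemma line_graph_claw_free (X : sgraph) (a b1 b2 b3 : line_graph X) :
    b1 <> b2 -> b1 <> b3 -> b2 <> b3 -> adj a b1 -> adj a b2 -> adj a b3 ->
  [\/ adj b1 b2, adj b1 b3 | adj b2 b3].
Proof.
move=> n12 n13 n23 [_ [p1 [ap1 bp1]]] [_ [p2 [ap2 bp2]]] [_ [p3 [ap3 bp3]]].
have [u [v [_ a_uv]]] := svalP a.
have share b c p q : b <> c -> sval b p -> sval c q -> p = q ->
    @adj (line_graph X) b c.
  by move=> nbc bp cq pq; split=> //; exists p; split=> //; rewrite pq.
move: ap1 ap2 ap3; rewrite a_uv /= => -[]p1E []p2E []p3E;
  by [ apply: Or31; apply: share bp1 bp2 _ => //; rewrite p1E p2E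
     | apply: Or32; apply: share bp1 bp3 _ => //; rewrite p1E p3E
     | apply: Or33; apply: share bp2 bp3 _ => //; rewrite p2E p3E].
Qed.

Section Star.
Variable V : Type.

(** [None] is the centre and the [Some x] are the leaves. *)
Definition star_adj (p q : option V) : Prop := isSome p <> isSome q.

Fact star_adj_sym p q : star_adj p q -> star_adj q p.
Proof. by move=> pq qp; apply: pq. Qed.

Fact star_adj_irrefl p : ~ star_adj p p.
Proof. by []. Qed.

Definition star : sgraph := SGraph star_adj_sym star_adj_irrefl.

Fact star_is_edge (x : V) : is_edge ([set None; Some x]%classic : set star).
Proof. by exists None, (Some x). Qed.

Definition star_edge (x : V) : edge star := exist _ _ (star_is_edge x).

Lemma star_edge_inj : injective star_edge.
Proof.
move=> x y /(congr1 sval) /= eq_xy.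
have: [set None; Some y]%classic (Some x) by rewrite -eq_xy; right.
by case=> // -[].
Qed.

Lemma star_edge_surj (a : edge star) : exists x, star_edge x = a.
Proof.
have [[x|] [[y|] [adj_pq a_pq]]] := svalP a; try by case: adj_pq.
- by exists x; apply: edge_inj; rewrite a_pq /= setUC.
- by exists y; apply: edge_inj; rewrite a_pq.
Qed.

Lemma star_edge_bij : bijective star_edge.
Proof.
have [g gK] := choice star_edge_surj.
by exists g => // x; apply: star_edge_inj; rewrite gK.
Qed.

End Star.

(** Any two edges of a star share the centre, so its line graph is complete,
    with one vertex for each leaf. *)
Lemma complete_is_line_graph (Y : sgraph) :
  (forall x y : Y, x <> y -> adj x y) -> is_line_graph Y.
Proof.
move=> completeY; exists (star Y), (@star_edge Y).
  exact: star_edge_bij.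
move=> x y; split=> [adj_xy | [ne_xy _]].
  split; last by exists None; split; left.
  by move=> eq_xy; move: adj_xy; rewrite (@star_edge_inj _ _ _ eq_xy) => /adj_irrefl.
by apply: completeY => eq_xy; apply: ne_xy; rewrite eq_xy.
Qed.

Lemma commute_mulr_cancel (gT : finGroupType) (x y : gT) :
  commute x (x * y)%g -> commute x y.
Proof. by rewrite /commute -mulgA => /mulgI. Qed.

Lemma commute_mull_cancel (gT : finGroupType) (x y : gT) :
  commute y (x * y)%g -> commute x y.
Proof. by rewrite /commute mulgA => /mulIg. Qed.

Theorem theorem3p1 (gT : finGroupType) (G : {group gT}) :
  is_line_graph (commuting_graph G) <-> abelian G.
Proof.
split=> [[X [f [g fK gK] f_adj]] | /centsP cGG]; last first.
  apply: complete_is_line_graph => x y ne_xy; split=> //.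
  exact: cGG (svalP x) _ (svalP y).
apply/centsP=> x Gx y Gy; apply: contrapT => ncxy.
have Gxy : (x * y)%g \in G by rewrite groupM.
pose one : commuting_graph G := exist _ 1%g (group1 G).
pose vx : commuting_graph G := exist _ x Gx.
pose vy : commuting_graph G := exist _ y Gy.
pose vxy : commuting_graph G := exist _ (x * y)%g Gxy.
have nc_x_xy : ~ commute x (x * y)%g by move/commute_mulr_cancel.
have nc_y_xy : ~ commute y (x * y)%g by move/commute_mull_cancel.
have f_neq (u v : commuting_graph G) : ~ commute (sval u) (sval v) -> f u <> f v.
  by move=> ncuv /(can_inj fK) uv; apply: ncuv; rewrite uv.
(* A vertex failing to commute with some [z] is distinct from the identity. *)
have f_one (u : commuting_graph G) z : ~ commute (sval u) z -> adj (f one) (f u).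
  move=> ncuz; apply/f_adj; split; last exact: commute_sym (commute1 _).
  by move=> one_u; apply: ncuz; rewrite -one_u; apply: commute_sym (commute1 _).
have ncyx : ~ commute y x by move/commute_sym.
have nc_xy_x : ~ commute (x * y)%g x by move/commute_sym.
have := @line_graph_claw_free X (f one) (f vx) (f vy) (f vxy)
  (f_neq vx vy ncxy) (f_neq vx vxy nc_x_xy) (f_neq vy vxy nc_y_xy)
  (f_one vx y ncxy) (f_one vy x ncyx) (f_one vxy x nc_xy_x).
by case=> /f_adj[].
Qed.
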